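(* Let $n,p\in\mathbb{N}$. Let $\xi_1,\dots,\xi_I$ be an enumeration of $\mathcal{I}(n,p)=\{\xi\in\mathbb{N}_0^n:|\xi|_1\le p\}$. Then the coefficient matrix $\boldsymbol{K}\in\mathbb{R}^{I\times I}$ for $\kappa=0$, given by $$K_{i,j}=\sum_{\beta\in\mathcal{G}_j}\beta^{2\xi_i},\qquad 1\le i,j\le I,$$ is non-singular.
   Context: $\mathbb{N}=\{1,2,\dots\}$, $\mathbb{N}_0=\{0,1,\dots\}$; $|\xi|_1=\sum_l|\xi_l|$; $\beta^{\gamma}=\prod_l\beta_l^{\gamma_l}$ with the convention $0^0=1$. $\mathcal{G}_j$ is the set of distinct vectors $((-1)^{k_1}\xi_{j,1},\dots,(-1)^{k_n}\xi_{j,n})$ with $k_1,\dots,k_n\in\{0,1\}$, where $\xi_{j,l}$ is the $l$-th coordinate of $\xi_j$. *)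

(* Defs.v *)
From HB Require Import structures.
From mathcomp Require Import all_boot all_order all_algebra.
From mathcomp Require Import reals.

Set Implicit Arguments.
Unset Strict Implicit.
Unset Printing Implicit Defensive.

Import Order.TTheory GRing.Theory Num.Theory.
Local Open Scope ring_scope.

(* Multi-indices in N_0^n are row vectors over nat. *)
Definition mnorm1 n (xi : 'rV[nat]_n) : nat := (\sum_(l < n) xi 0%R l)%N.

Definition multi_index_set n p : pred 'rV[nat]_n :=
  [pred xi | (mnorm1 xi <= p)%N].
Arguments multi_index_set : clear implicits.

Definition enumerates (T : eqType) (N : nat) (xi : 'I_N -> T) (A : pred T) : Prop :=
  injective xi /\ forall a : T, a \in A <-> exists i, xi i = a.

(* The convention 0^0 = 1 is that of the ring power. *)
Definition monomial (R : realType) n (beta : 'rV[R]_n) (gamma : 'rV[nat]_n) : R :=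
  \prod_(l < n) beta 0 l ^+ gamma 0 l.

Definition sign_flip (R : realType) n (k : {ffun 'I_n -> bool})
    (xi : 'rV[nat]_n) : 'rV[R]_n :=
  \row_(l < n) ((-1) ^+ k l * (xi 0 l)%:R).

(* Duplicate-free: sign flips of the zero coordinates of xi yield the same vector. *)
Definition sign_orbit (R : realType) n (xi : 'rV[nat]_n) : seq 'rV[R]_n :=
  undup [seq sign_flip R k xi | k : {ffun 'I_n -> bool}].

Definition coef_matrix (R : realType) n N (xi : 'I_N -> 'rV[nat]_n) : 'M[R]_N :=
  \matrix_(i < N, j < N)
    \sum_(beta <- sign_orbit R (xi j)) monomial beta (xi i *+ 2).

(* Main.v *)
(** Since even powers do not see signs, [K i j] is the positive factor
    [|G_j|] times [\prod_l t (xi_j l) ^ (xi_i l)] with distinct nodes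
    [t m = m ^ 2].  A vector in the right kernel of [K] thus gives weights on
    the points [t xi_j] annihilating every polynomial with exponents in
    [I(n, p)].  Among these are the Newton polynomials
    [N_a(x) = \prod_l \prod_(m < a_l) (x_l - t m)] for [|a|_1 <= p]; [N_a]
    vanishes at [t b] unless [a <= b] coordinatewise, and not at [t a].
    Testing against [N_a] by downward induction on [|a|_1] kills all weights. *)
Require Import Defs.
From HB Require Import structures.
From mathcomp Require Import all_boot all_order all_algebra.
From mathcomp Require Import reals.

Set Implicit Arguments.
Unset Strict Implicit.
Unset Printing Implicit Defensive.

Import Order.TTheory GRing.Theory Num.Theory.
Local Open Scope ring_scope.

Definition newton_poly (F : idomainType) (t : nat -> F) (k : nat) : {poly F} :=
  \prod_(m < k) ('X - (t m)%:P).

Lemma size_newton_poly (F : idomainType) (t : nat -> F) k :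
  size (newton_poly t k) = k.+1.
Proof.
rewrite /newton_poly -(big_mkord xpredT (fun m => 'X - (t m)%:P)).
by rewrite size_prod_XsubC size_iota subn0.
Qed.

Lemma newton_poly_eq0 (F : idomainType) (t : nat -> F) (t_inj : injective t)
    k b : ((newton_poly t k).[t b] == 0) = (b < k)%N.
Proof.
rewrite horner_prod; apply/prodf_eq0/idP => [[m _]|lt_bk].
  by rewrite hornerXsubC subr_eq0 => /eqP/t_inj->.
by exists (Ordinal lt_bk); rewrite // hornerXsubC subrr.
Qed.

(** A sum of coordinatewise inequalities is an equality only if each of them is. *)
Lemma mnorm1_le_eq n (a b : 'rV[nat]_n) :
  (forall l, a 0%R l <= b 0%R l)%N -> (mnorm1 b <= mnorm1 a)%N -> b = a.
Proof.
move=> le_ab le_ba; apply/rowP => l; apply/eqP.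
have /leqif_sum : forall l, true ->
    (a 0%R l <= b 0%R l ?= iff (a 0%R l == b 0%R l))%N by move=> k _; split.
case=> le_sum; rewrite eqn_leq le_sum le_ba /= => /esym/forallP/(_ l).
by rewrite eq_sym.
Qed.

Section GridVandermonde.
Variables (F : idomainType) (t : nat -> F) (n p N : nat).
Variables (xi : 'I_N -> 'rV[nat]_n) (w : 'I_N -> F).
Hypothesis t_inj : injective t.
Hypothesis xi_enum : enumerates xi (multi_index_set n p).
Hypothesis w_monomial : forall i,
  \sum_j w j * \prod_l t (xi j 0 l) ^+ xi i 0 l = 0.

(** Every monomial in the expansion of the Newton product has an exponent below [a] coordinatewise,
    hence one of the [xi i], where [w_monomial] applies. *)
Lemma sum_weights_newton (a : 'rV[nat]_n) : (mnorm1 a <= p)%N ->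
  \sum_j w j * \prod_l (newton_poly t (a 0 l)).[t (xi j 0 l)] = 0.
Proof.
move=> le_ap.
have le_alp l : (a 0%R l <= p)%N.
  by apply: leq_trans le_ap; rewrite /mnorm1 (bigD1 l) //= leq_addr.
(* The uniform bound [p] on the exponents in all coordinates lets the product of sums be distributed
   over a single function type. *)
pose c (f : {ffun 'I_n -> 'I_p.+1}) :=
  \prod_l (newton_poly t (a 0 l))`_(f l).
have expand j : \prod_l (newton_poly t (a 0 l)).[t (xi j 0 l)] =
    \sum_(f : {ffun 'I_n -> 'I_p.+1}) c f * \prod_l t (xi j 0 l) ^+ f l.
  under eq_bigr => l _.
    rewrite (horner_coef_wide (n := p.+1)); last first.
      by rewrite size_newton_poly ltnS.
    over.
  by rewrite bigA_distr_bigA; apply: eq_bigr => f _; rewrite -big_split.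
under eq_bigr => j _ do rewrite expand mulr_sumr.
rewrite exchange_big big1 //= => f _.
under eq_bigr => j _ do rewrite mulrCA.
rewrite -mulr_sumr.
(* If [f l] exceeds [a 0 l], it lies beyond the degree of the factor at [l], so [c f] vanishes. *)
have [le_fa|/forallPn[l gt_fa]] :=
    boolP [forall l, f l <= a 0%R l]%N; last first.
  rewrite /c (bigD1 l) //= nth_default ?mul0r // size_newton_poly.
  by rewrite ltnNge.
have [i xiE] : exists i, xi i = \row_l (f l : nat).
  apply/(xi_enum.2 _); rewrite inE; apply: leq_trans le_ap.
  by apply: leq_sum => l _; rewrite mxE; apply: (forallP le_fa).
rewrite -[RHS](mulr0 (c f)) -[in RHS](w_monomial i); congr (_ * _).
apply: eq_bigr => j _; congr (_ * _).
by apply: eq_bigr => l _; rewrite xiE mxE.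
Qed.

Lemma weights_eq0 j : w j = 0.
Proof.
have le_xip k : (mnorm1 (xi k) <= p)%N.
  by have /(_ (ex_intro _ k erefl)) := (xi_enum.2 (xi k)).2.
(* Induction on [p - mnorm1 (xi j)] treats the indices of largest norm first. *)
have [d] := ubnP (p - mnorm1 (xi j)); elim: d j => // d IHd j lt_d.
have := sum_weights_newton (le_xip j); rewrite (bigD1 j) //=.
rewrite [X in _ + X]big1 => [|k ne_kj].
  rewrite addr0 => /eqP; rewrite mulf_eq0 => /orP[/eqP//|/prodf_eq0[l _]].
  by rewrite newton_poly_eq0 // ltnn.
(* For a larger norm the weight is zero by induction; otherwise [xi j <= xi k] coordinatewise would
   force [k = j], so some Newton factor vanishes. *)
have [lt_jk|le_kj] := ltnP (mnorm1 (xi j)) (mnorm1 (xi k)).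
  rewrite IHd ?mul0r // -ltnS; apply: leq_trans lt_d.
  by rewrite ltnS ltn_sub2l ?(leq_trans lt_jk).
have [/forallP le_jk|/forallPn[l lt_kj]] :=
    boolP [forall l, xi j 0%R l <= xi k 0%R l]%N.
  by case/eqP: ne_kj; apply: xi_enum.1; apply: mnorm1_le_eq.
apply/eqP; rewrite mulf_eq0; apply/orP; right; apply/prodf_eq0.
by exists l; rewrite // newton_poly_eq0 // ltnNge.
Qed.

End GridVandermonde.

Lemma monomial_sign_flip_double (R : realType) n (k : {ffun 'I_n -> bool})
    (x g : 'rV[nat]_n) :
  monomial (sign_flip R k x) (g *+ 2) = \prod_l ((x 0 l)%:R ^+ 2) ^+ g 0 l.
Proof.
apply: eq_bigr => l _; rewrite mulr2n !mxE exprD -exprMn -expr2.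
by rewrite [X in X ^+ _ = _]exprMn sqrr_sign mul1r.
Qed.

Lemma coef_matrixE (R : realType) n N (xi : 'I_N -> 'rV[nat]_n) i j :
  coef_matrix R xi i j = (size (sign_orbit R (xi j)))%:R *
    \prod_l ((xi j 0 l)%:R ^+ 2) ^+ xi i 0 l.
Proof.
rewrite mxE (eq_big_seq (fun=> \prod_l ((xi j 0 l)%:R ^+ 2) ^+ xi i 0 l)).
  by rewrite big_const_seq count_predT iter_addr_0 mulr_natl.
move=> beta; rewrite mem_undup => /mapP[k _ ->].
by rewrite monomial_sign_flip_double.
Qed.

Lemma size_sign_orbit_gt0 (R : realType) n (x : 'rV[nat]_n) :
  (0 < size (sign_orbit R x))%N.
Proof.
have : sign_flip R [ffun=> false] x \in sign_orbit R x.
  by rewrite mem_undup; apply: image_f.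
by case: (sign_orbit R x).
Qed.

Theorem corollary4p12 (R : realType) (n p : nat) (n_gt0 : (0 < n)%N)
    (p_gt0 : (0 < p)%N) (N : nat) (xi : 'I_N -> 'rV[nat]_n)
    (xi_enum : enumerates xi (multi_index_set n p)) :
  coef_matrix R xi \in unitmx.
Proof.
(* Transposing turns the right kernel of the matrix into a kernel of row vectors. *)
rewrite -unitmx_tr -row_free_unit; apply: inj_row_free => v vK0.
pose t (m : nat) : R := m%:R ^+ 2.
have t_inj : injective t.
  move=> m m' /eqP; rewrite eqrXn2 ?ler0n // => /eqP/eqP.
  by rewrite eqr_nat => /eqP.
apply/rowP => j; rewrite mxE; apply/eqP.
(* The orbit size depends on the column only, so it is absorbed into the weight and, being positive,
   cancelled afterwards. *)
have /eqP : v 0 j * (size (sign_orbit R (xi j)))%:R = 0.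
  apply: (@weights_eq0 _ t n p _ xi
    (fun j => v 0 j * (size (sign_orbit R (xi j)))%:R)) => // i.
  have /rowP/(_ i) := vK0; rewrite !mxE; apply: etrans.
  by apply: eq_bigr => k _; rewrite mxE coef_matrixE mulrA.
rewrite mulf_eq0 pnatr_eq0 => /orP[//|].
by rewrite -leqn0 leqNgt size_sign_orbit_gt0.
Qed.
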